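(* Let $\Delta\ge 2$ be an even integer. For $t\in\{1,\dots,\Delta-2\}$ let $H^{\Delta}_t$ be the multigraph with vertex set $\{u_t,v^0_t,v^1_t,\dots,v^{\Delta-1}_t\}$ whose edges are: one edge $u_tv^j_t$ for each $j\in\{0,1,\dots,\Delta-1\}$, and exactly $t$ parallel edges between $v^j_t$ and $v^{j+1}_t$ for each even $j\in\{0,2,4,\dots,\Delta-2\}$. Let $G^{\Delta}$ be the disjoint union of the multigraphs $H^{\Delta}_t$ for $t=1,2,\dots,\Delta-2$. Then the palette index $\check s(G^{\Delta})$ satisfies $$\frac{\Delta}{2}\left(\Delta-2\right)<\check s(G^{\Delta})<\left(\Delta+1\right)\left(\Delta-2\right).$$
   Context: Multigraphs are finite, undirected and loopless (parallel edges allowed). A coloring of a multigraph $G$ is a proper edge-coloring, i.e. a map $c:E(G)\to C$ into a finite set $C$ of colors such that any two distinct edges sharing an endpoint (including parallel edges) receive distinct colors; the number of colors is not restricted. The palette of a vertex $x$ with respect to $c$ is the set $P_c(x)$ of colors of the edges incident with $x$. The palette index $\check s(G)$ is the minimum, over all colorings $c$ of $G$ (with any finite color set), of the number of distinct palettes $|\{P_c(x):x\in V(G)\}|$.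
   Formalization: The case Δ = 2 is excluded (Δ is even and greater than 2): for Δ = 2 the disjoint union is empty, its palette index is 0, and the claimed inequalities would read 0 < 0 < 0, which is false. *)

(* Defs.v *)
From HB Require Import structures.
From mathcomp Require Import all_boot.
From mathcomp Require Import boolp.

Set Implicit Arguments.
Unset Strict Implicit.
Unset Printing Implicit Defensive.

(* Edges form a type of their own, so that parallel edges are allowed;
   [card_ends] makes the multigraph undirected and loopless. *)
Record multigraph := Multigraph {
  vertex : finType;
  edge : finType;
  ends : edge -> {set vertex};
  card_ends : forall e : edge, #|ends e| = 2 }.

Section Palettes.
Variable G : multigraph.

Definition proper_coloring (C : finType) (c : edge G -> C) : Prop :=
  forall e f : edge G, e <> f -> ends e :&: ends f <> set0 -> c e <> c f.

Definition palette (C : finType) (c : edge G -> C) (x : vertex G) : {set C} :=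
  [set c e | e : edge G & x \in ends e].

Definition num_palettes (C : finType) (c : edge G -> C) : nat :=
  #|[set palette c x | x : vertex G]|.

Definition realizes_palettes (n : nat) : Prop :=
  exists (C : finType) (c : edge G -> C),
    proper_coloring c /\ num_palettes c = n.

Lemma realizes_palettes_ex : exists n, `[< realizes_palettes n >].
Proof.
exists (num_palettes (@id (edge G))); apply/asboolP.
by exists (edge G), id; split.
Qed.

Definition palette_index : nat := ex_minn realizes_palettes_ex.

Lemma palette_index_realized : realizes_palettes palette_index.
Proof. by rewrite /palette_index; case: ex_minnP => n /asboolP. Qed.

Lemma palette_index_le (C : finType) (c : edge G -> C) :
  proper_coloring c -> palette_index <= num_palettes c.
Proof.
move=> pc; rewrite /palette_index; case: ex_minnP => n _; apply.
by apply/asboolP; exists C, c.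
Qed.

End Palettes.

Section DisjointUnion.
Variables (I : finType) (G : I -> multigraph).

Definition dunion_ends (e : {i : I & edge (G i)}) : {set {i : I & vertex (G i)}} :=
  [set Tagged (fun i => vertex (G i)) x | x in ends (tagged e)].

Lemma card_dunion_ends e : #|dunion_ends e| = 2.
Proof.
rewrite card_imset ?card_ends // => x y /eqP.
by rewrite eq_Tagged /= => /eqP.
Qed.

Definition dunion : multigraph := Multigraph card_dunion_ends.

End DisjointUnion.

Section Construction.
Variable D : nat.

(* [None] is the vertex u_t and [Some j] is the vertex v^j_t. *)
Definition H_vertex : finType := option 'I_D.

(* The even indices j = 0, 2, ..., D - 2 (for D even). *)
Definition even_index : finType := {j : 'I_D | ~~ odd j && (j.+1 < D)}.

(* [inl j] is the edge u_t v^j_t, and [inr (j, k)] is the k-th of the t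
   parallel edges between v^j_t and v^(j+1)_t. *)
Definition H_edge (t : nat) : finType := ('I_D + even_index * 'I_t)%type.

(* [ordS] is the cyclic successor, but it does not wrap around here, because
   j.+1 < D for every j in [even_index]. *)
Definition H_ends (t : nat) (e : H_edge t) : {set H_vertex} :=
  match e with
  | inl j => [set None; Some j]
  | inr (j, _) => [set Some (val j); Some (ordS (val j))]
  end.

Lemma card_H_ends (t : nat) (e : H_edge t) : #|H_ends e| = 2.
Proof.
case: e => [j|[[j /= /andP[_ ltj]] k]] /=; rewrite cards2 //.
suff -> : Some j != Some (ordS j) by [].
apply/eqP=> -[] /(congr1 val) /= /eqP.
by rewrite modn_small // ltn_eqF.
Qed.

Definition H_graph (t : nat) : multigraph := Multigraph (@card_H_ends t).

(* t = i.+1 ranges over 1, ..., D - 2. For D = 2 the union is empty: G_graph 2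
   has no vertices and palette index 0. *)
Definition G_graph : multigraph :=
  dunion (fun i : 'I_(D - 2) => H_graph i.+1).

End Construction.

(* Main.v *)
Require Import Defs.
From mathcomp Require Import all_boot.
From mathcomp Require Import all_algebra.

(** Fix a proper coloring, and let [a_j] be the color of [u_t v^j_t].  The
    palettes of [v^j_t] and [v^(j+1)_t] ([j] even) consist of the same [t] colors
    plus [a_j], respectively [a_(j+1)], so their indicator vectors differ by
    [1_(a_j) - 1_(a_(j+1))].  The [a_j] are distinct, hence these [D / 2]
    differences are linearly independent; as they lie in the span of the
    indicator vectors of the palettes, at least [D / 2] palettes occur on the
    [v^j_t].  These palettes have size [t + 1], so different [t] give different
    palettes, and the palette of [u_t], of size [D], is a further one.
    For the upper bound, all the [u_t] can be given the same palette. *)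

Set Implicit Arguments.
Unset Strict Implicit.
Unset Printing Implicit Defensive.

(** The identity matrix of size [n] factors through dimension [#|F|]: row [i] of [A] is the formal
    difference of [P i] and [Q i], column [j] of [B] tells which members of [F] contain [a j], and
    the last hypothesis makes their product the identity. *)
Lemma leq_card_separated (C : finType) (n : nat) (F : {set {set C}})
    (P Q : 'I_n -> {set C}) (a : 'I_n -> C) :
  (forall i, P i \in F) -> (forall i, Q i \in F) ->
  (forall i j, (a j \in P i) = (i == j) + (a j \in Q i) :> nat) ->
  n <= #|F|.
Proof.
move=> PF QF aPQ; pose S (k : 'I_#|F|) := enum_val k.
pose A := (\matrix_(i < n, k < #|F|) ((P i == S k)%:R - (Q i == S k)%:R : rat))%R.
pose B := (\matrix_(k < #|F|, j < n) ((a j \in S k)%:R : rat))%R.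
apply: (@mulmx1_min _ _ _ A B); apply/matrixP=> i j; rewrite !mxE.
have pick (X : {set C}) : X \in F ->
    (\sum_k (X == S k)%:R * (a j \in S k)%:R = (a j \in X)%:R :> rat)%R.
  move=> XF; rewrite (bigD1 (enum_rank_in XF X)) //= /S enum_rankK_in // eqxx.
  rewrite GRing.mul1r big1 ?GRing.addr0 // => k; apply: contraNeq.
  case: (X =P enum_val k) => [Xk _|_]; last by rewrite GRing.mul0r eqxx.
  by apply/eqP/enum_val_inj; rewrite enum_rankK_in.
under eq_bigr do rewrite !mxE GRing.mulrBl.
by rewrite GRing.sumrB !pick // aPQ GRing.natrD GRing.addrK.
Qed.

(** * Palettes and proper colorings of a disjoint union *)

Section DisjointUnionPalettes.
Variables (I : finType) (G : I -> multigraph).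

Lemma mem_dunion_ends i (x : vertex (G i)) (e : edge (dunion G)) :
  (Tagged (fun i => vertex (G i)) x \in ends e) =
  [exists f : edge (G i), (e == Tagged (fun i => edge (G i)) f) && (x \in ends f)].
Proof.
apply/imsetP/existsP => [[y] | [f /andP[/eqP-> xf]]]; last by exists x.
case: e y => j f /= y yf E; have ij : i = j by case: E.
(* Only after the tags are identified do [x] and [y] live in the same type. *)
case: j / ij f y yf E => f y yf /eqP; rewrite eq_Tagged /= => /eqP ->.
by exists f; rewrite eqxx.
Qed.

Variables (C : finType) (c : edge (dunion G) -> C).

Definition dunion_restr i (e : edge (G i)) : C := c (Tagged (fun i => edge (G i)) e).
Arguments dunion_restr : clear implicits.

Lemma palette_dunion i (x : vertex (G i)) :
  palette c (Tagged (fun i => vertex (G i)) x) = palette (dunion_restr i) x.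
Proof.
apply/setP=> k; apply/imsetP/imsetP => [[e]|[f]].
  rewrite inE mem_dunion_ends => /existsP[f /andP[/eqP-> xf]] ->.
  by exists f; rewrite ?inE.
rewrite inE => xf ->; exists (Tagged (fun i => edge (G i)) f) => //.
by rewrite inE mem_dunion_ends; apply/existsP; exists f; rewrite eqxx.
Qed.

Lemma proper_coloring_dunion :
  proper_coloring c <-> forall i, proper_coloring (dunion_restr i).
Proof.
split=> [pc i e f ef /eqP/set0Pn[x /setIP[xe xf]] | pc e f ef].
  apply: pc => [/eqP|]; first by rewrite eq_Tagged /= => /eqP.
  apply/eqP/set0Pn; exists (Tagged (fun i => vertex (G i)) x); apply/setIP.
  by rewrite !mem_dunion_ends; split; apply/existsP;
     [exists e | exists f]; rewrite eqxx.
move=> /eqP/set0Pn[[i x] /setIP[]]; rewrite !(mem_dunion_ends (i := i) x).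
move=> /existsP[e' /andP[/eqP Ee xe]] /existsP[f' /andP[/eqP Ef xf]].
rewrite {}Ee {}Ef in ef *; apply: pc => [E|]; first by apply: ef; rewrite E.
by apply/eqP/set0Pn; exists x; rewrite inE xe.
Qed.

End DisjointUnionPalettes.

Lemma card_palette (G : multigraph) (C : finType) (c : edge G -> C) x :
  proper_coloring c -> #|palette c x| = #|[set e | x \in ends e]|.
Proof.
move=> pc; rewrite /palette card_in_imset //= => e f; rewrite !inE => xe xf.
case: (e =P f) => // ef /(pc _ _ ef); case.
by apply/eqP/set0Pn; exists x; rewrite inE xe.
Qed.

(** * Palettes in a single component *)

Section HPalettes.
Variables (D t : nat) (C : finType) (c : edge (H_graph D t) -> C).
Hypothesis pc : proper_coloring c.
Implicit Types (j : 'I_D) (p : even_index D).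

Definition in_pair p j := (j == val p) || (j == ordS (val p)).

Lemma ordS_even p : ordS (val p) = (val p).+1 :> nat.
Proof. by case: p => j /= /andP[_ ?]; rewrite modn_small. Qed.

Lemma odd_even_index p : odd (val p) = false.
Proof. by case: p => j /= /andP[/negPf]. Qed.

(** The base of a pair containing [j] is [j] rounded down to an even number. *)
Lemma in_pair_inj p q j : in_pair p j -> in_pair q j -> p = q.
Proof.
have half r : in_pair r j -> (val r : nat) = j./2.*2.
  have evr := even_halfK (negbT (odd_even_index r)).
  move=> /orP[]/eqP->; first by rewrite evr.
  by rewrite ordS_even -[(val r).+1]add1n halfD odd_even_index add0n evr.
by move=> /half jp /half jq; apply/val_inj/val_inj; rewrite /= jp jq.
Qed.

(** Indexing by [option 'I_t], with [None] for the spoke, makes the degree [t.+1] immediate. *)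
Lemma incident_v p j : in_pair p j ->
  [set e : edge (H_graph D t) | Some j \in ends e] =
  [set if k is Some k' then inr (p, k') else inl j | k : option 'I_t].
Proof.
move=> pj; apply/setP=> e; rewrite inE; apply/idP/imsetP => [|[[k|] _ ->]].
- case: e => [i|[q k]] /=; rewrite !inE /=.
    by move=> /eqP[->]; exists None.
  by move=> qj; exists (Some k) => //; rewrite (in_pair_inj pj qj).
- by rewrite in_set2.
- by rewrite set22.
Qed.

Lemma palette_v p j : in_pair p j ->
  palette c (Some j) = c (inl j) |: [set c (inr (p, k)) | k : 'I_t].
Proof.
move=> pj; rewrite /palette (incident_v pj) -imset_comp; apply/setP=> x.
apply/imsetP/setU1P => [[[k|] _ ->]|[->|/imsetP[k _ ->]]]; last 2 first.
- by exists None.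
- by exists (Some k).
- by right; apply/imsetP; exists k.
- by left.
Qed.

Lemma card_palette_v p j : in_pair p j -> #|palette c (Some j)| = t.+1.
Proof.
move=> pj; rewrite card_palette // (incident_v pj) card_imset.
  by rewrite card_option card_ord.
by move=> [k|] [l|] // [->].
Qed.

Lemma color_spoke_inj : injective (fun j => c (inl j)).
Proof.
move=> i j; case: (i =P j) => // ij /pc; case; first by case.
by apply/eqP/set0Pn; exists None; rewrite !inE.
Qed.

Lemma color_spoke_notin p j : in_pair p j ->
  c (inl j) \notin [set c (inr (p, k)) | k : 'I_t].
Proof.
move=> pj; apply/imsetP=> -[k _]; apply: pc => //.
by apply/eqP/set0Pn; exists (Some j); rewrite !inE eqxx.
Qed.

Lemma card_palette_u : #|palette c None| = D.
Proof.
rewrite card_palette // -[RHS]card_ord -cardsT.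
rewrite -(card_imset [set: 'I_D] (f := (inl : 'I_D -> H_edge D t))); last first.
  by move=> i j [].
apply: eq_card => -[i|[p k]]; rewrite inE.
  by rewrite set21 imset_f.
by rewrite /= in_set2; apply/esym/imsetP => -[].
Qed.

Hypothesis D_even : ~~ odd D.

Fact even_ordinal_subproof (i : 'I_D./2) : i.*2 < D.
Proof. by rewrite -[ltnRHS]even_halfK // ltn_double ltn_ord. Qed.

Fact even_index_subproof (i : 'I_D./2) :
  ~~ odd (Ordinal (even_ordinal_subproof i)) &&
  ((Ordinal (even_ordinal_subproof i)).+1 < D).
Proof.
by rewrite /= odd_double /= -[ltnRHS]even_halfK // -doubleS leq_double ltn_ord.
Qed.

Definition even_index_of (i : 'I_D./2) : even_index D :=
  exist _ (Ordinal (even_ordinal_subproof i)) (even_index_subproof i).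

Lemma even_index_of_inj : injective even_index_of.
Proof.
by move=> i j /(congr1 (fun p => val (val p))) /double_inj E; apply: val_inj.
Qed.

Lemma leq_num_palettes_v :
  D./2 <= #|[set palette c (Some (if b then val p else ordS (val p)))
             | p : even_index D, b : bool]|.
Proof.
pose v b i := if b then val (even_index_of i) else ordS (val (even_index_of i)).
have pair b i : in_pair (even_index_of i) (v b i).
  by case: b; rewrite /in_pair /= eqxx ?orbT.
(* In each pair, [P] is the palette of the even vertex, [Q] that of its odd partner, and [a] the
   color of the even spoke. The parallel edges contribute equally to both. *)
apply: (@leq_card_separated _ _ _ (fun i => palette c (Some (v true i)))
  (fun i => palette c (Some (v false i))) (fun i => c (inl (v true i)))).
- by move=> i; apply/imset2P; exists (even_index_of i) true.
- by move=> i; apply/imset2P; exists (even_index_of i) false.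
move=> i j; rewrite !(palette_v (pair _ i)) !in_setU1 !(inj_eq color_spoke_inj).
have vtt : (v true j == v true i) = (i == j).
  by rewrite (inj_eq val_inj) (inj_eq even_index_of_inj) eq_sym.
have vtf : (v true j == v false i) = false.
  apply/eqP=> /(congr1 (fun k : 'I_D => odd k)).
  by rewrite /v ordS_even /= !odd_double.
(* For distinct [i] and [j] both sides test the parallel edges only; for equal ones the spoke color
   must be absent from them. *)
rewrite vtt vtf; case: eqP => // ->.
by rewrite (negPf (color_spoke_notin (pair true j))).
Qed.

End HPalettes.

(** * The two bounds for the whole graph *)

Lemma card_G_graph D : #|vertex (G_graph D)| = (D + 1) * (D - 2).
Proof.
rewrite card_tagged sumnE big_map big_enum /=.
under eq_bigr do rewrite card_option card_ord.
by rewrite sum_nat_const card_ord mulnC addn1.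
Qed.

Lemma palette_index_gt D : 2 < D -> ~~ odd D ->
  D./2 * (D - 2) < palette_index (G_graph D).
Proof.
move=> D_gt2 D_even; have [C [c [pc <-]]] := palette_index_realized (G_graph D).
have pci := (proper_coloring_dunion c).1 pc.
have D2_gt0 : 0 < D - 2 by rewrite subn_gt0.
pose i0 : 'I_(D - 2) := Ordinal D2_gt0.
pose vpal (i : 'I_(D - 2)) :=
  [set palette (dunion_restr c (i := i)) (Some (if b then val p else ordS (val p)))
             | p : even_index D, b : bool].
pose upal := palette (dunion_restr c (i := i0)) None.
have card_vpal i P : P \in vpal i -> #|P| = i.+2.
  case/imset2P=> p b _ _ ->; apply: (card_palette_v (pci i) (p := p)).
  by case: b; rewrite /in_pair eqxx ?orbT.
have disj i j : i != j -> [disjoint vpal i & vpal j].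
  apply: contraNT => /pred0Pn[P /andP[/card_vpal Pi /card_vpal Pj]].
  by apply/eqP/val_inj/eqP; rewrite -2!eqSS -Pi -Pj.
have upalN : upal \notin \bigcup_i vpal i.
  (* Sizes differ: [upal] has [D] colors, while [i < D - 2] gives [i.+2 < D]. *)
  apply/bigcupP=> -[i _ /card_vpal]; rewrite card_palette_u // => E.
  by have := ltn_ord i; rewrite ltn_subRL add2n -E ltnn.
apply: (@leq_trans #|upal |: \bigcup_i vpal i|); last first.
  apply/subset_leq_card/subsetP=> P /setU1P[->|/bigcupP[i _ /imset2P[p b _ _ ->]]].
    by rewrite /upal -palette_dunion imset_f.
  by rewrite -palette_dunion imset_f.
rewrite cardsU1 upalN add1n ltnS -sum1_card partition_disjoint_bigcup //.
rewrite mulnC -[X in X * _]card_ord -sum_nat_const; apply: leq_sum => i _.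
by rewrite sum1_card leq_num_palettes_v.
Qed.

Lemma palette_index_lt D : 3 < D ->
  palette_index (G_graph D) < (D + 1) * (D - 2).
Proof.
move=> D_gt3.
(* Spokes with the same index [j] share a color across components; every other edge has a color of
   its own. Thus [c] is injective on each component. *)
pose c (e : edge (G_graph D)) : 'I_D + edge (G_graph D) :=
  if tagged e is inl j then inl j else inr e.
have pc : proper_coloring c.
  apply/proper_coloring_dunion => i e f + _; rewrite /dunion_restr /c.
  case: e f => [j|p] [k|q] //= ne; first by case=> E; apply: ne; rewrite E.
  move=> [] /eqP; rewrite -tag_eqE /tag_eq /= eqxx tagged_asE => /eqP E.
  by apply: ne; rewrite E.
apply: leq_ltn_trans (palette_index_le pc) _.
have D2_gt1 : 1 < D - 2 by rewrite ltn_subRL.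
pose u (i : 'I_(D - 2)) : vertex (G_graph D) :=
  @Tagged _ i (fun i => vertex (H_graph D i.+1)) None.
pose u0 := u (Ordinal (ltnW D2_gt1)).
have palu i : palette c (u i) = [set inl j | j : 'I_D].
  rewrite /u palette_dunion; apply/setP=> k.
  apply/imsetP/imsetP=> [[[j|[p l]]]|[j _ ->]]; rewrite ?inE //=.
    by move=> _ ->; exists j.
  by exists (inl j); rewrite ?inE.
(* The bound is the number of vertices, so it suffices that removing [u0] loses no palette: the hub
   of a second component has the same one. *)
rewrite -card_G_graph -cardsT (cardsD1 u0) inE add1n ltnS.
apply: leq_trans (leq_imset_card (palette c) _).
apply/subset_leq_card/subsetP=> P /imsetP[x _ ->].
have [->|xu] := eqVneq x u0; last by apply: imset_f; rewrite !inE xu.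
by rewrite palu -(palu (Ordinal D2_gt1)); apply: imset_f; rewrite !inE.
Qed.

Theorem theorem1 (D : nat) (D_gt2 : 2 < D) (D_even : ~~ odd D) :
  D./2 * (D - 2) < palette_index (G_graph D) /\
  palette_index (G_graph D) < (D + 1) * (D - 2).
Proof.
split; first exact: palette_index_gt.
(* An even [D] above 2 is at least 4, which provides two components. *)
by apply: palette_index_lt; case: D D_gt2 D_even => [|[|[|[|D]]]].
Qed.
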